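(* Let $p$ be a prime with $p\neq 2,3,11$. If $p\equiv 1\pmod 4$ and $p=a^2+b^2$ with $a,b\in\mathbb{Z}$ and $4\mid a-1$, then $$P_{[p/6]}\!\left(\frac{21\sqrt{33}}{121}\right)\equiv \left(\frac{33}{p}\right)(-33)^{\frac{p-1}{4}}\,2a\pmod p.$$ If $p\equiv 3\pmod 4$, then $P_{[p/6]}\!\left(\frac{21\sqrt{33}}{121}\right)\equiv 0\pmod p$.
   Context: $\left(\frac{33}{p}\right)$ is the Legendre symbol. $[x]$ is the greatest integer not exceeding $x$. $P_n(x)$ is the $n$-th Legendre polynomial: $P_0(x)=1$, $P_1(x)=x$, $(n+1)P_{n+1}(x)=(2n+1)xP_n(x)-nP_{n-1}(x)$ for $n\ge 1$. Congruences modulo $p$ are in $R_p[\sqrt{33}]=\{u+v\sqrt{33}:u,v\in R_p\}$, where $R_p$ is the ring of rational numbers whose denominator is coprime to $p$: $\alpha\equiv\beta\pmod p$ means $\alpha-\beta\in pR_p[\sqrt{33}]$. *)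

(* Defs.v *)
From mathcomp Require Import all_boot all_order all_algebra all_field.

Set Implicit Arguments.
Unset Strict Implicit.
Unset Printing Implicit Defensive.

Import Order.TTheory GRing.Theory Num.Theory.
Local Open Scope ring_scope.

(* Legendre polynomials, by Bonnet's recurrence with n = m.+1:                *)
(*   (n + 1) P_{n+1} = (2n + 1) X P_n - n P_{n-1}.                            *)
Fixpoint legendre (F : numFieldType) (n : nat) : {poly F} :=
  match n with
  | 0 => 1
  | 1 => 'X
  | (m.+1 as k).+1 =>
      (k.+1)%:R^-1 *:
        ((2 * k + 1)%:R *: ('X * legendre F k) - k%:R *: legendre F m)
  end.

Lemma legendre_rec (F : numFieldType) (n : nat) : (1 <= n)%N ->
  (n + 1)%:R *: legendre F n.+1 =
  (2 * n + 1)%:R *: ('X * legendre F n) - n%:R *: legendre F n.-1.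
Proof.
case: n => [//|m] _; rewrite [legendre F m.+2]/= scalerA addn1.
by rewrite mulfV ?scale1r // pnatr_eq0.
Qed.

(* The Legendre symbol (a / p), for p an odd prime. *)
Definition legendre_symbol (a : int) (p : nat) : int :=
  if (p %| a)%Z then 0
  else if [exists x : 'I_p, ((x : nat)%:Z ^+ 2 == a %[mod p])%Z] then 1
  else -1.

Definition p_integral (p : nat) : pred rat :=
  [pred r : rat | coprime `|denq r| p].

Definition sqrt33 : algC := sqrtC 33.

(* The ring R_p[sqrt 33], R_p being the p-integral rationals. *)
Definition in_Rp_sqrt33 (p : nat) (z : algC) : Prop :=
  exists u v : rat,
    [/\ u \in p_integral p, v \in p_integral p & z = ratr u + ratr v * sqrt33].

Definition congr_mod (p : nat) (x y : algC) : Prop :=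
  exists2 z, in_Rp_sqrt33 p z & x - y = p%:R * z.

(* Main.v *)
Require Import Defs.
From mathcomp Require Import all_boot all_order all_algebra all_field.
From mathcomp Require Import cyclic ring zify.

(** Write [p = 6 r + 1 + 4 e] with [e] in {0, 1} (so [r = p %/ 6]) and
    [N = (p - 1) / 2 = 3 r + 2 e].  The argument [t = 21 sqrt 33 / 121] is the
    parameter of the elliptic curve [y^2 = x^3 - 11 x + 14], and the value
    [P_r(t)] mod [p] is its Hasse invariant, up to an explicit constant.

    Two things have to be compared.  On one side, let [chi] be the quadratic
    character mod [p].  By Euler's criterion and the vanishing of most power sums
    over the prime field, the sum of [chi(x^3 - 11 x + 14)] over [x] is mod [p]
    minus the coefficient of [x^(p-1)] in [(x^3 - 11 x + 14)^N]
    ([sum_qchar_hasse]).  On the other side, the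
    coefficient of [X^d] in [P_r] is explicit ([legendre_coef]).  Expanding
    the former in powers of the constant coefficient 14 and the latter in powers
    of [t], with exponents [d] such that [r = 2 k + d], the ratio of consecutive
    coefficients is a rational function of [k] and [d]; substituting
    [r = - (1 + 4 e) / 6] makes the two ratios equal mod [p] up to a constant
    factor, so the sums are proportional term by term ([hasse_legendre_num], [legendre_int_modp]).

    It remains to evaluate the character sum.  The cubic has the root 2, and
    quotienting the curve by the corresponding point of order two leads to
    [y^2 = x^3 - x]; the two sums are equal ([sum_qchar_isogeny]).  If
    [p = 3 mod 4] the latter vanishes since the cubic is odd and -1 is not a
    square.  If [p = 1 mod 4] it is a Jacobsthal sum [J(-1)]: computing the
    second moment of [J] gives [J(-1)^2 + J(-g)^2 = 4 p] for a nonsquare [g]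
    ([jacobsthal_two_squares]), so [J(-1) = 2 a] or [- 2 a] because a prime is
    a sum of two squares in one way only; the sign is read off mod 8, from the
    symmetries [x -> - x] and [x -> 1 / x] ([jacobsthal_mod8]).

    Finally the constants are matched ([legendre_int_1mod4]); this uses the
    quadratic character of 3, which is [(-1)^e] when [p = 1 mod 4]. *)

Set Implicit Arguments.
Unset Strict Implicit.
Unset Printing Implicit Defensive.

Import Order.TTheory GRing.Theory Num.Theory.
Local Open Scope ring_scope.

(** * The quadratic character of a finite field of odd order *)

Section QuadraticCharacter.

Variables (F : finFieldType) (N : nat).
Hypothesis cardF : #|F| = N.*2.+1.

Lemma half_card_gt0 : (0 < N)%N.
Proof. by have := finNzRing_gt1 F; rewrite cardF; case: N. Qed.

Lemma expf0_half : 0 ^+ N = 0 :> F.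
Proof. by rewrite expr0n eqn0Ngt half_card_gt0. Qed.

Lemma expf_fermat (x : F) : x != 0 -> x ^+ N.*2 = 1.
Proof.
move=> nzx; apply: (mulfI nzx).
by rewrite mulr1 -exprS -cardF expf_card.
Qed.

Lemma finField_primitive_root : exists z : F, N.*2.-primitive_root z.
Proof.
suff /hasP[z _ prim_z] : has N.*2.-primitive_root [seq x <- enum F | x != 0].
  by exists z.
have N0 := half_card_gt0.
apply: has_prim_root; first by rewrite double_gt0.
- apply/allP=> x; rewrite mem_filter => /andP[nzx _].
  by apply/unity_rootP/expf_fermat.
- by rewrite filter_uniq // enum_uniq.
rewrite size_filter -(leq_add2l (count (pred1 0) (enum F))).
have -> : count (fun x : F => x != 0) (enum F) = count (predC (pred1 0)) (enum F) by [].
by rewrite count_predC -cardE cardF count_uniq_mem ?enum_uniq // mem_enum.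
Qed.

Lemma expf_half (x : F) : x != 0 -> (x ^+ N == 1) || (x ^+ N == -1).
Proof.
by move=> /expf_fermat; rewrite -muln2 exprM => /eqP; rewrite sqrf_eq1.
Qed.

Lemma primitive_neq0 (z : F) : N.*2.-primitive_root z -> z != 0.
Proof.
move/prim_expr_order; apply: contra_eq_neq => ->.
by rewrite -muln2 exprM expf0_half expr0n eq_sym oner_eq0.
Qed.

Lemma primitive_half (z : F) : N.*2.-primitive_root z -> z ^+ N != 1.
Proof.
move=> prim_z; rewrite -(prim_order_dvd prim_z); apply/negP=> /dvdn_leq.
by have := half_card_gt0; lia.
Qed.

(** An element of order [2 N] has [N]-th power [-1], which therefore differs from
    [1]. *)
Lemma finField_two_neq0 : 2 != 0 :> F.
Proof.
have [z prim_z] := finField_primitive_root.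
have nz1 := primitive_half prim_z.
have := expf_half (primitive_neq0 prim_z); rewrite (negbTE nz1) /= => /eqP zN.
apply: contra nz1 => /eqP two0; rewrite zN.
by rewrite -subr_eq0 -opprD oppr_eq0 -two0.
Qed.

Lemma neq_opp1 : (-1 : F) != 1.
Proof.
by rewrite -subr_eq0 -opprD oppr_eq0; exact: finField_two_neq0.
Qed.

(** The sum of all elements is unchanged by the translation [x -> x + 1]. *)
Lemma card_finField_eq0 : #|F|%:R = 0 :> F.
Proof.
have S0 : \sum_(x : F) (x + 1) = \sum_(x : F) x.
  by rewrite [RHS](reindex_inj (addIr 1)).
move: S0; rewrite big_split /= sumr_const => /eqP.
by rewrite -subr_eq0 addrAC subrr add0r => /eqP.
Qed.

Definition qchar (x : F) : int :=
  if x == 0 then 0 else if x ^+ N == 1 then 1 else -1.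

Lemma qchar0 : qchar 0 = 0. Proof. by rewrite /qchar eqxx. Qed.

Lemma qcharE (x : F) : (qchar x)%:~R = x ^+ N.
Proof.
rewrite /qchar; case: eqVneq => [->|nzx].
  by rewrite expf0_half.
by case/orP: (expf_half nzx) => /eqP->; rewrite ?eqxx ?(negbTE neq_opp1).
Qed.

Lemma qcharP (x : F) : x != 0 -> (qchar x == 1) || (qchar x == -1).
Proof. by rewrite /qchar => /negbTE->; case: ifP. Qed.

(** A value in {0, 1, -1} is determined by its image in the field, as the
    characteristic is odd; identities between characters can thus be checked on
    [N]-th powers. *)
Lemma qchar_inj (x : F) (e : int) :
  (e == 0) || (e == 1) || (e == -1) -> x ^+ N = e%:~R -> qchar x = e.
Proof.
rewrite /qchar => /orP[/orP[]|] /eqP-> xN; rewrite ?xN.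
- by move/eqP: xN; rewrite expf_eq0 half_card_gt0 /= => ->.
- case: eqP => [x0|_]; last by rewrite eqxx.
  by move/eqP: xN; rewrite x0 expf0_half eq_sym oner_eq0.
rewrite (negbTE neq_opp1); case: eqP => // x0.
by move/eqP: xN; rewrite x0 expf0_half eq_sym oppr_eq0 oner_eq0.
Qed.

Lemma qcharM (x y : F) : qchar (x * y) = qchar x * qchar y.
Proof.
apply: qchar_inj; last by rewrite exprMn rmorphM /= !qcharE.
have [->|/qcharP xP] := eqVneq x 0; first by rewrite qchar0 !mul0r.
have [->|/qcharP yP] := eqVneq y 0; first by rewrite qchar0 mulr0.
by case/orP: xP => /eqP->; case/orP: yP => /eqP->.
Qed.

Lemma qchar1 : qchar 1 = 1.
Proof. by apply: qchar_inj; rewrite // expr1n. Qed.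

Lemma qchar_sqr (x : F) : x != 0 -> qchar (x ^+ 2) = 1.
Proof. by rewrite expr2 qcharM => /qcharP/orP[]/eqP->. Qed.

Lemma qchar_sqrM (x y : F) : x != 0 -> qchar (x ^+ 2 * y) = qchar y.
Proof. by move=> nzx; rewrite qcharM qchar_sqr // mul1r. Qed.

Lemma qchar_norm (x : F) : x != 0 -> qchar x ^+ 2 = 1.
Proof. by move=> /qcharP/orP[]/eqP->. Qed.

(** Euler's criterion: an [N]-th power equal to 1 forces an even exponent in terms
    of a primitive root. *)
Lemma qchar1_sqr (x : F) : qchar x = 1 -> exists y, x = y ^+ 2.
Proof.
move=> x1; have [z prim_z] := finField_primitive_root.
have xN : x ^+ N = 1 by rewrite -qcharE x1.
have [|i xE] := prim_rootP prim_z (x := x).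
  by rewrite -muln2 exprM xN expr1n.
have : (N.*2 %| i * N)%N by rewrite (prim_order_dvd prim_z) exprM -xE xN.
rewrite -[X in (X %| _)%N]mul2n dvdn_pmul2r ?half_card_gt0 // => /dvdnP[j ij].
by exists (z ^+ j); rewrite -exprM -ij.
Qed.

Lemma qcharN1_exists : exists g, qchar g = -1.
Proof.
have [z prim_z] := finField_primitive_root.
exists z; rewrite /qchar (negbTE (primitive_half prim_z)).
by rewrite (negbTE (primitive_neq0 prim_z)).
Qed.

Lemma qchar_cases (x : F) : [|| qchar x == 0, qchar x == 1 | qchar x == -1].
Proof. by rewrite /qchar; case: (x == 0) => //; case: ifP. Qed.

Lemma qchar_eq0 (x : F) : (qchar x == 0) = (x == 0).
Proof. by rewrite /qchar; case: (x == 0) => //; case: ifP. Qed.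

Lemma sum_qchar : \sum_(x : F) qchar x = 0.
Proof.
have [g gN1] := qcharN1_exists.
have nzg : g != 0 by rewrite -qchar_eq0 gN1.
have : \sum_x qchar x = - \sum_x qchar x.
  rewrite [LHS](reindex_inj (mulfI nzg)) -sumrN.
  by apply: eq_bigr => x _; rewrite qcharM gN1 mulN1r.
by move/eqP; rewrite -addr_eq0 -mulr2n mulrn_eq0 => /eqP.
Qed.

Lemma card_sqrt (x : F) : (#|[set t : F | t ^+ 2 == x]|)%:Z = 1 + qchar x.
Proof.
have [->|nzx] := eqVneq x 0.
  rewrite qchar0 (_ : [set t | _] = [set 0]) ?cards1 //.
  by apply/setP=> t; rewrite !inE expf_eq0.
have /orP[/eqP x1|/eqP xN1] := qcharP nzx; last first.
  rewrite (_ : [set t | _] = set0) ?cards0 ?xN1 //.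
  apply/setP=> t; rewrite !inE; apply/eqP => tx.
  by move: xN1 nzx; rewrite -tx expf_eq0 /= => + nzt; rewrite qchar_sqr.
have [s xs] := qchar1_sqr x1; rewrite x1.
have nzs : s != 0 by move: nzx; rewrite xs expf_eq0.
rewrite (_ : [set t | _] = [set s; -s]) ?cards2.
  rewrite -addr_eq0 -mulr2n -mulr_natr mulf_eq0 (negbTE nzs).
  by rewrite (negbTE finField_two_neq0).
by apply/setP=> t; rewrite !inE xs eqf_sqr.
Qed.

Lemma sum_comp_sqr (f : F -> int) :
  \sum_t f (t ^+ 2) = \sum_k (1 + qchar k) * f k.
Proof.
rewrite (partition_big (fun t => t ^+ 2) xpredT) //=.
apply: eq_bigr => k _; rewrite -card_sqrt -sum1_card.
rewrite (eq_bigr (fun=> f k)) => [|t /eqP->//].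
rewrite sumr_const sum1_card [_%:Z * _]mulrC -mulr_natr natz; congr (_ * Posz _).
by apply: eq_card => t; rewrite inE.
Qed.

(** Multiplication by a primitive root [z] permutes the field, so that the sum is
    killed by [z^k - 1]. *)
Lemma sum_exp (k : nat) : (0 < k)%N ->
  \sum_(x : F) x ^+ k = - (N.*2 %| k)%:R.
Proof.
move=> k0; have [z prim_z] := finField_primitive_root.
have nzz := primitive_neq0 prim_z.
case: (boolP (_ %| _)%N) => [/dvdnP[j kj]|nd].
  have : #|F|%:R = 0 :> F := card_finField_eq0.
  rewrite -sum1_card natr_sum (bigD1 0) //= [in X in _ -> X](bigD1 0) //=.
  rewrite expr0n eqn0Ngt k0 add0r [1 + _]addrC => /eqP.
  rewrite addr_eq0 => /eqP <-; apply: eq_bigr => x nzx.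
  by rewrite kj mulnC exprM expf_fermat // expr1n.
apply/eqP; rewrite oppr0; move: nd; rewrite (prim_order_dvd prim_z).
apply: contraNT => nzS; rewrite -subr_eq0.
suff /eqP : (z ^+ k - 1) * \sum_(x : F) x ^+ k = 0.
  by rewrite mulf_eq0 (negbTE nzS) orbF.
rewrite mulrBl mul1r mulr_sumr [X in _ - X](reindex_inj (mulfI nzz)).
by rewrite -sumrB big1 // => x _; rewrite exprMn subrr.
Qed.

(** Below degree [2 (#|F| - 1)], the monomial of degree [#|F| - 1] is the only one
    whose power sum does not vanish (the constant term contributes a multiple of
    [#|F|]). *)
Lemma sum_horner (Q : {poly F}) : (size Q <= N.*2 + N.*2)%N ->
  \sum_(x : F) Q.[x] = - Q`_(N.*2).
Proof.
move=> sQ; have N0 := half_card_gt0.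
under eq_bigr => x _ do rewrite (horner_coef_wide _ sQ).
have ltN : (N.*2 < N.*2 + N.*2)%N by lia.
rewrite exchange_big /= (bigD1 (Ordinal ltN)) //= -mulr_sumr sum_exp ?double_gt0 // dvdnn mulrN1.
rewrite big1 ?addr0 // => i; rewrite -val_eqE /= => ni.
rewrite -mulr_sumr; case: (posnP i) => [->|i0].
  under eq_bigr do rewrite expr0.
  by rewrite sumr_const card_finField_eq0 mulr0.
rewrite sum_exp // (_ : (_ %| _)%N = false) ?oppr0 ?mulr0 //.
apply/negP => /dvdnP[[|[|j]] ij].
- by rewrite ij in i0.
- by rewrite ij mul1n eqxx in ni.
by have := ltn_ord i; rewrite ij !mulSn; lia.
Qed.
End QuadraticCharacter.

(** * Character sums of cubics *)

Section CubicSums.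

Variables (F : finFieldType) (N : nat).
Hypothesis cardF : #|F| = N.*2.+1.
Local Notation chi := (@qchar F N).

(** The equation [x + 1 / x = t] says [(2 x - t)^2 = t^2 - 4], hence has
    [1 + chi (t^2 - 4)] solutions. *)
Lemma sum_add_inv (f : F -> int) :
  \sum_(x : F | x != 0) f (x + x^-1) =
  \sum_(t : F) (1 + chi (t ^+ 2 - 4)) * f t.
Proof.
rewrite (partition_big (fun x => x + x^-1) xpredT) //=.
apply: eq_bigr => t _; rewrite -(card_sqrt cardF).
rewrite (eq_bigr (fun=> f t)) => [|x /andP[_ /eqP->//]].
rewrite sumr_const [_%:Z * _]mulrC -[LHS]mulr_natr natz; congr (_ * Posz _).
have n2 := finField_two_neq0 cardF.
pose h x := 2 * x - t.
have injh : injective h by move=> x y /addIr /(mulfI n2).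
rewrite -(card_imset _ injh); apply: eq_card => y; rewrite !inE.
have hE x : x != 0 -> (h x ^+ 2 == t ^+ 2 - 4) = (x + x^-1 == t).
  move=> nzx; rewrite -subr_eq0 -[RHS]subr_eq0 /h.
  have -> : (2 * x - t) ^+ 2 - (t ^+ 2 - 4) = 2 ^+ 2 * x * (x + x^-1 - t) by field.
  by rewrite !mulf_eq0 (negbTE n2) (negbTE nzx).
apply/imsetP/eqP => [[x]|yt].
  by rewrite unfold_in => /andP[nzx xt] ->; apply/eqP; rewrite hE.
have yh : y = h ((y + t) / 2) by rewrite /h; field.
exists ((y + t) / 2) => //; rewrite unfold_in.
have nz : (y + t) / 2 != 0.
  apply/eqP => y0; move: yt; rewrite yh /h y0 => /eqP; rewrite -subr_eq0.
  rewrite (_ : _ - _ = 2 ^+ 2); last by ring.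
  by rewrite expf_eq0 (negbTE n2).
by rewrite nz -hE // -yh yt eqxx.
Qed.

(** The isogeny of degree two, on character sums.  Moving the root 2 to the origin
    gives [x (x^2 + 6 x + 1)], that is [x^2 (x + 1 / x + 6)]; the sum over
    [t = x + 1 / x] produces the cubic [(t + 6) (t^2 - 4)], whose three roots are
    in arithmetic progression. *)
Lemma sum_qchar_isogeny :
  \sum_(x : F) chi (x ^+ 3 - 11 * x + 14) = \sum_(x : F) chi (x * (x ^+ 2 - 1)).
Proof.
have n2 := finField_two_neq0 cardF.
have n4 : 4 != 0 :> F.
  by rewrite (_ : 4 = 2 ^+ 2 :> F) ?expf_eq0 ?(negbTE n2) //; ring.
rewrite (reindex_inj (addIr 2)) /=.
rewrite (bigD1 0) //= (_ : _ + 14 = 0); last by ring.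
rewrite qchar0 add0r.
rewrite (eq_bigr (fun x => chi (x + x^-1 + 6))); last first.
  move=> x nzx; rewrite -[RHS](qchar_sqrM cardF _ nzx); congr chi.
  by field.
rewrite (sum_add_inv (fun t => chi (t + 6))).
rewrite (eq_bigr (fun t => chi (t + 6) + chi ((t ^+ 2 - 4) * (t + 6)))); last first.
  by move=> t _; rewrite mulrDl mul1r -(qcharM cardF).
rewrite big_split /= [X in X + _](_ : _ = 0); last first.
  by rewrite -[RHS](sum_qchar cardF) [RHS](reindex_inj (addIr 6)).
rewrite add0r.
(* The roots -6, -2 and 2 are sent to -1, 0 and 1, up to the square factor 8^2. *)
pose h (s : F) := 4 * s - 2.
have injh : injective h by move=> x y /addIr /(mulfI n4).
rewrite (reindex_inj injh); apply: eq_bigr => s _.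
have n8 : 8 != 0 :> F.
  by rewrite (_ : 8 = 2 ^+ 3 :> F) ?expf_eq0 ?(negbTE n2) //; ring.
rewrite -[RHS](qchar_sqrM cardF _ n8); congr chi; rewrite /h; ring.
Qed.

Lemma sum_qchar_odd : chi (-1) = -1 -> \sum_(x : F) chi (x * (x ^+ 2 - 1)) = 0.
Proof.
move=> cN1.
have : \sum_(x : F) chi (x * (x ^+ 2 - 1)) = - \sum_(x : F) chi (x * (x ^+ 2 - 1)).
  rewrite [LHS](reindex_inj oppr_inj) -sumrN.
  by apply: eq_bigr => x _; rewrite sqrrN mulNr -[X in chi X]mulN1r (qcharM cardF (-1)) cN1 mulN1r.
by move/eqP; rewrite -addr_eq0 -mulr2n mulrn_eq0 => /eqP.
Qed.

(** After a translation and division by a square, [k (k + c)] becomes [1 + c / k],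
    and [c / k] runs over the nonzero elements. *)
Lemma sum_qchar_quadratic (u v : F) :
  \sum_(k : F) chi ((k + u) * (k + v)) = #|F|%:Z * (u == v)%:R - 1.
Proof.
rewrite (reindex_inj (addIr (- u))) /= (bigD1 0) //=.
rewrite (_ : (0 - u + u) * _ = 0) ?qchar0 ?add0r; last by ring.
case: eqVneq => [->|nuv].
  rewrite mulr1 (eq_bigr (fun=> 1)); last first.
    by move=> k nzk; rewrite subrK -expr2 (qchar_sqr cardF).
  rewrite sumr_const -[LHS]/(_ *+ _) natz.
  have := cardC1 (0 : F); rewrite /= => ->.
  by rewrite cardF /=; lia.
pose c := v - u; have nzc : c != 0 by rewrite subr_eq0 eq_sym.
have injc : injective (fun k => c / k) by move=> x y /(mulfI nzc) /invr_inj.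
rewrite mulr0 sub0r (reindex_inj injc) /=.
rewrite (eq_bigl (fun k => k != 0)); last first.
  by move=> k; rewrite mulf_eq0 invr_eq0 (negbTE nzc).
rewrite (eq_bigr (fun k => chi (k + 1))); last first.
  move=> k nzk; have nzck : c / k != 0 by rewrite mulf_neq0 ?invr_eq0.
  rewrite -[RHS](qchar_sqrM cardF _ nzck); congr chi.
  by rewrite subrK /c; field.
apply/eqP; rewrite eq_sym -subr_eq0 -opprD oppr_eq0; apply/eqP.
rewrite -[RHS](sum_qchar cardF) [RHS](reindex_inj (addIr 1)) [RHS](bigD1 0) //=.
by rewrite add0r (qchar1 cardF).
Qed.

(** The family of twists of [y^2 = x^3 + x]; the value at [-1] is the sum to be
    computed, and the whole family is needed for the second moment. *)
Definition jacobsthal (k : F) : int := \sum_(x : F) chi (x * (x ^+ 2 + k)).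

Lemma jacobsthal_twist (k t : F) : t != 0 ->
  jacobsthal (k * t ^+ 2) = chi t * jacobsthal k.
Proof.
move=> nzt; rewrite /jacobsthal (reindex_inj (mulfI nzt)) mulr_sumr.
apply: eq_bigr => x _; rewrite -(qcharM cardF) -[RHS](qchar_sqrM cardF _ nzt).
congr chi; ring.
Qed.

Lemma jacobsthal0 : jacobsthal 0 = 0.
Proof.
rewrite -[RHS](sum_qchar cardF); apply: eq_bigr => x _.
have [->|nzx] := eqVneq x 0; first by rewrite mul0r.
by rewrite addr0 mulrC (qchar_sqrM cardF).
Qed.

(** Exchanging sums, [sum_qchar_quadratic] leaves only the pairs [y = x] and
    [y = - x], which contribute equally when [-1] is a square. *)
Lemma sum_jacobsthal_sqr : chi (-1) = 1 ->
  \sum_(k : F) jacobsthal k ^+ 2 = #|F|%:Z * (2 * (#|F|%:Z - 1)).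
Proof.
move=> cN1.
have n2 := finField_two_neq0 cardF.
have expand k : jacobsthal k ^+ 2 = \sum_(x : F) \sum_(y : F)
    chi (x * y) * chi ((k + x ^+ 2) * (k + y ^+ 2)).
  rewrite expr2 {1}/jacobsthal mulr_suml; apply: eq_bigr => x _.
  rewrite /jacobsthal mulr_sumr; apply: eq_bigr => y _.
  rewrite -!(qcharM cardF); congr chi; ring.
rewrite (eq_bigr _ (fun k _ => expand k)) exchange_big /=.
rewrite (eq_bigr (fun x => \sum_(y : F)
    chi (x * y) * (#|F|%:Z * (x ^+ 2 == y ^+ 2)%:R - 1))); last first.
  move=> x _; rewrite exchange_big; apply: eq_bigr => y _ /=.
  by rewrite -sum_qchar_quadratic mulr_sumr.
transitivity (\sum_(x : F) (#|F|%:Z * (2 * (x != 0)%:R) - chi x * \sum_(y : F) chi y)).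
  apply: eq_bigr => x _.
  rewrite (eq_bigr (fun y => #|F|%:Z * (chi (x * y) * (x ^+ 2 == y ^+ 2)%:R)
                           - chi x * chi y)); last first.
    by move=> y _; rewrite (qcharM cardF); ring.
  rewrite sumrB -!mulr_sumr; congr (_ * _ - _).
  case: eqVneq => [->|nzx].
    by rewrite mulr0 big1 // => y _; rewrite mul0r qchar0 mul0r.
  have nxNx : - x != x.
    by rewrite -subr_eq0 -opprD oppr_eq0 -mulr2n -mulr_natr mulf_neq0.
  rewrite (bigD1 x) //= (bigD1 (- x)) //= sqrrN eqxx mulr1 mulrN -mulN1r.
  rewrite (qcharM cardF (-1)) cN1 -expr2 (qchar_sqr cardF nzx).
  rewrite big1 => [|y /andP[nyx nyNx]]; first by [].
  rewrite eq_sym eqf_sqr (negbTE nyx) /=.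
  by rewrite (negbTE nyNx) mulr0.
rewrite sumrB -mulr_sumr -mulr_suml (sum_qchar cardF) mulr0 subr0 -mulr_sumr.
congr (_ * (_ * _)); rewrite (bigD1 0) //= eqxx add0r.
rewrite (eq_bigr (fun=> 1)) => [|x ->//].
rewrite sumr_const -[LHS]/(_ *+ _) natz.
by have := cardC1 (0 : F); rewrite /= => ->; rewrite cardF /=; lia.
Qed.

(** The square of [jacobsthal k] depends only on the square class of [k], so the
    second moment is a combination of the values at [-1] and at a nonsquare [-g]. *)
Lemma jacobsthal_two_squares : chi (-1) = 1 ->
  exists m : int, jacobsthal (-1) ^+ 2 + m ^+ 2 = 4 * #|F|%:Z.
Proof.
move=> cN1; have [g gN1] := qcharN1_exists cardF.
have nzg : g != 0 by rewrite -(qchar_eq0 N) gN1.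
exists (jacobsthal (- g)).
pose f (k : F) : int := jacobsthal (- k) ^+ 2.
have f0 : f 0 = 0 by rewrite /f oppr0 jacobsthal0.
have sum_f : \sum_(k : F) f k = #|F|%:Z * (2 * (#|F|%:Z - 1)).
  by rewrite -(sum_jacobsthal_sqr cN1) [RHS](reindex_inj oppr_inj).
have sum_sqr a : \sum_(t : F) f (a * t ^+ 2) = (#|F|%:Z - 1) * f a.
  rewrite (bigD1 0) //= expr0n mulr0 f0 add0r.
  rewrite (eq_bigr (fun=> f a)) => [|t nzt].
    rewrite sumr_const; have := cardC1 (0 : F); rewrite /= => ->.
    by rewrite -mulr_natl natz cardF /=; congr (_ * _); lia.
  by rewrite /f -mulNr jacobsthal_twist // exprMn (qchar_norm N nzt) mul1r.
(* The two parametrizations k = t^2 and k = g t^2 cover each nonzero k twice in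
   total, as 1 + chi k and 1 - chi k add up to 2. *)
have := sum_sqr 1; under eq_bigr do rewrite mul1r.
rewrite (sum_comp_sqr cardF f) => sum1.
have := sum_sqr g; rewrite (sum_comp_sqr cardF (fun k => f (g * k))) => sumg.
have sumg' : \sum_(k : F) (1 + chi k) * f (g * k) = \sum_(k : F) (1 - chi k) * f k.
  rewrite [RHS](reindex_inj (mulfI nzg)); apply: eq_bigr => k _.
  by rewrite (qcharM cardF) gN1 mulN1r opprK.
have : (#|F|%:Z - 1) * (f 1 + f g) = (#|F|%:Z - 1) * (4 * #|F|%:Z).
  rewrite mulrDr -sum1 -sumg sumg' -big_split /=.
  rewrite (eq_bigr (fun k => 2 * f k)); last by move=> k _; ring.
  by rewrite -mulr_sumr sum_f; ring.
by apply: mulfI; rewrite cardF; have := half_card_gt0 cardF; lia.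
Qed.

(** The summand [f x = chi (x (x^2 - 1))] vanishes exactly at 0, 1 and -1, hence
    the sum is [#|F| - 3 - 2 n] with [n] the number of [x] where [f x = -1].  As
    [f] is invariant under [x -> - x] and [x -> 1 / x] and takes the value 1 at
    the square roots of [-1], these [x] come in orbits of size exactly four. *)
Lemma jacobsthal_mod8 : chi (-1) = 1 ->
  exists m : int, jacobsthal (-1) = #|F|%:Z - 3 - 8 * m.
Proof.
move=> cN1; have [i /esym i2] := qchar1_sqr cardF cN1.
have n2 := finField_two_neq0 cardF; have n11 := neq_opp1 cardF.
pose f (x : F) := chi (x * (x ^+ 2 - 1)).
have f0 : f 0 = 0 by rewrite /f mul0r qchar0.
have f_eq0 x : (f x == 0) = (x \in [set 0; 1; -1]).
  rewrite !inE -orbA -eqf_sqr expr1n -[x ^+ 2 == 1]subr_eq0 -mulf_eq0.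
  exact: qchar_eq0.
(* Here x (x^2 - 1) = - 2 x = (1 - x)^2. *)
have fi x : x ^+ 2 = -1 -> f x = 1.
  move=> x2; rewrite /f x2 (_ : x * _ = (1 - x) ^+ 2).
    apply: (qchar_sqr cardF); rewrite subr_eq0; apply: contra_neq n11 => x1.
    by rewrite -x2 -x1 expr1n.
  rewrite (_ : (1 - x) ^+ 2 = 1 - 2 * x + x ^+ 2); last by ring.
  by rewrite x2; ring.
have fN x : f (- x) = f x.
  by rewrite /f sqrrN mulNr -[X in chi X]mulN1r (qcharM cardF (-1)) cN1 mul1r.
have fV x : f x^-1 = f x.
  have [->|nzx] := eqVneq x 0; first by rewrite invr0.
  have nzv : (x^-1) ^+ 2 != 0 by rewrite expf_neq0 ?invr_eq0.
  rewrite -fN /f -[RHS](qchar_sqrM cardF _ nzv); congr chi; by field.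
pose B := [set x | f x == -1].
have BP x : x \in B -> [&& x != 0, x ^+ 2 != 1 & x ^+ 2 != -1].
  rewrite inE => /eqP fx; apply/and3P; split.
  - by apply: contra_eq_neq fx => ->; rewrite f0.
  - apply: contra_eq_neq fx => x2; rewrite /f x2 subrr mulr0 qchar0 //.
  - by apply: contra_eq_neq fx => x2; rewrite fi.
have [m cardB] : exists m, #|B| = (m * 4)%N.
  pose u (x : F) := (x - x^-1) ^+ 2.
  exists #|preim_partition u B|.
  apply: card_uniform_partition (preim_partitionP u B) => A /imsetP[x xB ->].
  have /and3P[nzx x21 x2N1] := BP x xB.
  have fx : f x = -1 by apply/eqP; rewrite inE in xB.
  have -> : [set y in B | u x == u y] = [set x; - x; x^-1; - x^-1].
    apply/setP=> y; rewrite inE; apply/andP/idP => [[yB] |].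
      have /and3P[nzy _ _] := BP y yB.
      rewrite -subr_eq0 => /eqP uxy.
      have : (x - y) * (x + y) * (x * y - 1) * (x * y + 1) = 0.
        rewrite (_ : _ * (_ + 1) = (x * y) ^+ 2 * (u x - u y)).
          by rewrite uxy mulr0.
        by rewrite /u; field; rewrite nzx nzy.
      move/eqP; rewrite !mulf_eq0 -!orbA !inE -!orbA.
      rewrite !subr_eq0 !addr_eq0.
      case/or4P => [/eqP->|/eqP->|/eqP xy|/eqP xy].
      - by rewrite eqxx.
      - by rewrite opprK eqxx !orbT.
      - by rewrite (mulr1_eq xy) eqxx !orbT.
      - have xV : x^-1 = - y by apply: mulr1_eq; rewrite mulrN xy opprK.
        by rewrite xV opprK eqxx !orbT.
    rewrite !inE /u => /orP[/orP[/orP[]|]|] /eqP->;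
      rewrite ?fN ?fV ?fN ?fx ?eqxx; split=> //; apply/eqP;
      rewrite ?invrN ?invrK; ring.
  have nNx (y : F) : y != 0 -> y != - y.
    by move=> nzy; rewrite -subr_eq0 opprK -mulr2n -mulr_natr mulf_neq0.
  have nVx : x != x^-1.
    by apply: contra_neq x21 => xV; rewrite expr2 {2}xV mulfV.
  have nNVx : x != - x^-1.
    by apply: contra_neq x2N1 => xV; rewrite expr2 {2}xV mulrN mulfV.
  rewrite -!setUA !cardsU1 cards1 !inE eqr_oppLR eqr_opp.
  by rewrite !negb_or !nNx ?invr_eq0 // nVx nNVx.
exists m%:Z.
have cardf0 : #|[set x | f x == 0]| = 3.
  rewrite (_ : [set x | f x == 0] = [set 0; 1; -1]); last first.
    by apply/setP=> x; rewrite inE f_eq0.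
  by rewrite -setUA cardsU1 cards2 !inE [1 == _]eq_sym n11 eq_sym oner_eq0
     eq_sym oppr_eq0 oner_eq0.
have -> : jacobsthal (-1) = \sum_(x : F) (1 - (f x == 0)%:R - 2 * (f x == -1)%:R).
  apply: eq_bigr => x _; rewrite -/(f x).
  have : [|| f x == 0, f x == 1 | f x == -1] by exact: qchar_cases.
  by case/or3P => /eqP->.
have count (P : pred F) : \sum_(x : F) (P x)%:R = #|[set x | P x]|%:Z.
  rewrite -sum1dep_card -natz natr_sum [RHS]big_mkcond.
  by apply: eq_bigr => x _; case: (P x).
rewrite !sumrB -mulr_sumr sumr_const.
rewrite (count (fun x => f x == 0)) (count (fun x => f x == -1)) cardf0 cardB.
by rewrite [X in X - _ - _]natz PoszM; ring.
Qed.
End CubicSums.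

(** * Jacobsthal sums and representations as a sum of two squares *)

(** By the identity of Brahmagupta, a [p] dividing [a d - b c] forces either
    [a d = b c], which gives the conclusion, or [a c + b d = 0], which would give
    [d^2 = a^2] against parity. *)
Lemma two_squares_unique_aux (p : nat) (a b c d : int) :
    prime p -> odd p -> p%:Z = a ^+ 2 + b ^+ 2 -> p%:Z = c ^+ 2 + d ^+ 2 ->
    ~~ (2 %| a)%Z -> ~~ (2 %| c)%Z -> (p %| a * d - b * c)%Z ->
  c ^+ 2 = a ^+ 2.
Proof.
move=> pr_p odd_p pab pcd odd_a odd_c /dvdzP[k adbc].
have p0 : (0 < p)%N by exact: prime_gt0.
have brahmagupta : (a * d - b * c) ^+ 2 + (a * c + b * d) ^+ 2 = p%:Z ^+ 2.
  by rewrite [RHS]expr2 {1}pab pcd; ring.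
have [k0|k_neq0] := eqVneq k 0.
  rewrite k0 mul0r in adbc.
  have adE : a * d = b * c by apply/eqP; rewrite -subr_eq0 adbc.
  apply: (@mulfI _ p%:Z); first by lia.
  rewrite {1}pab {1}pcd.
  have -> : (c ^+ 2 + d ^+ 2) * a ^+ 2 = (a * c) ^+ 2 + (a * d) ^+ 2 by ring.
  by rewrite adE; ring.
have acbd : a * c + b * d = 0.
  have k1 : 0 < k ^+ 2 by rewrite exprn_even_gt0.
  have sE : (a * c + b * d) ^+ 2 = p%:Z ^+ 2 * (1 - k ^+ 2).
    by apply: (addrI ((a * d - b * c) ^+ 2)); rewrite brahmagupta adbc; ring.
  apply/eqP; rewrite -sqrf_eq0 eq_le sqr_ge0 andbT sE.
  by apply: mulr_ge0_le0; [exact: sqr_ge0 | lia].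
exfalso.
have : p%:Z * d ^+ 2 = p%:Z * a ^+ 2.
  rewrite {1}pab {1}pcd.
  have -> : (c ^+ 2 + d ^+ 2) * a ^+ 2 = (a * c) ^+ 2 + (a * d) ^+ 2 by ring.
  have -> : a * c = - (b * d) by apply/eqP; rewrite -addr_eq0 acbd.
  ring.
move=> /(@mulfI _ p%:Z) da.
have d2 : d ^+ 2 = a ^+ 2 by apply: da; lia.
have a1 : exists a', a = 2 * a' + 1 by exists (a %/ 2)%Z; clear -odd_a; lia.
have c1 : exists c', c = 2 * c' + 1 by exists (c %/ 2)%Z; clear -odd_c; lia.
case: a1 c1 => a' a1 [c' c1]; rewrite d2 a1 c1 in pcd.
by clear -odd_p pcd; lia.
Qed.

(** [p] divides [(a d)^2 - (b c)^2 = p (a^2 - c^2)], so by changing the sign of [b]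
    it may be assumed to divide [a d - b c]. *)
Lemma two_squares_unique (p : nat) (a b c d : int) :
    prime p -> odd p -> p%:Z = a ^+ 2 + b ^+ 2 -> p%:Z = c ^+ 2 + d ^+ 2 ->
    ~~ (2 %| a)%Z -> ~~ (2 %| c)%Z ->
  c ^+ 2 = a ^+ 2.
Proof.
move=> pr_p odd_p pab pcd odd_a odd_c.
have : (p %| (a * d - b * c) * (a * d + b * c))%Z.
  apply/dvdzP; exists (a ^+ 2 - c ^+ 2).
  have -> : (a * d - b * c) * (a * d + b * c) =
    a ^+ 2 * (c ^+ 2 + d ^+ 2) - c ^+ 2 * (a ^+ 2 + b ^+ 2) by ring.
  by rewrite -pab -pcd; ring.
rewrite dvdzE abszM Euclid_dvdM // => /orP[] dv.
  exact: (@two_squares_unique_aux p a b c d).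
apply: (@two_squares_unique_aux p a (- b) c d) => //.
  by rewrite sqrrN.
by rewrite mulNr opprK dvdzE.
Qed.

(** Half of the sum is an odd integer [c] with [p = c^2 + d^2], hence is [a] or
    [- a], and its residue mod 4 is [2 j - 1]. *)
Lemma jacobsthal_two_squaresE (F : finFieldType) (N p j : nat) (a b : int) :
    #|F| = N.*2.+1 -> #|F| = p -> prime p -> p = (4 * j + 1)%N ->
    p%:Z = a ^+ 2 + b ^+ 2 -> (4 %| a - 1)%Z -> qchar N (-1 : F) = 1 ->
  jacobsthal N (-1 : F) = - 2 * a * (-1) ^+ j.
Proof.
move=> cardF cardFp pr_p pj pab a1 cN1.
have [m] := jacobsthal_mod8 cardF cN1.
have [n] := jacobsthal_two_squares cardF cN1.
rewrite cardFp; set T := jacobsthal _ _ => Tn Tm.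
pose c : int := 2 * j%:Z - 1 - 4 * m.
have Tc : T = 2 * c by rewrite Tm /c; clear -pj; lia.
have [d nd] : exists d, n = 2 * d.
  exists (n %/ 2)%Z.
  have [e|e] : (n = 2 * (n %/ 2)%Z) \/ (n = 2 * (n %/ 2)%Z + 1) by lia.
    by [].
  by exfalso; move: Tn; rewrite Tc e; clear; lia.
have pcd : p%:Z = c ^+ 2 + d ^+ 2 by move: Tn; rewrite Tc nd; clear; lia.
have odd_p : odd p by clear -pj; lia.
have odd_a : ~~ (2 %| a)%Z by clear -a1; lia.
have odd_c : ~~ (2 %| c)%Z by rewrite /c; clear; lia.
have /eqP := two_squares_unique pr_p odd_p pab pcd odd_a odd_c.
rewrite eqf_sqr Tc => h.
have {h}h : (c = a) \/ (c = - a) by case/orP: h => /eqP; [left | right].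
have cE : c = 2 * j%:Z - 1 - 4 * m by [].
clear -a1 h cE; rewrite mulrAC -signr_odd.
by case: (boolP (odd j)) => oj; rewrite ?expr1 ?expr0; lia.
Qed.

(** * Coefficients of the Legendre polynomials *)

(** The integer [(2 k + 2 d)! / (k! (k + d)! d!)], which is up to sign the
    coefficient of [X^d] in [2^n P_n] for [n = 2 k + d]. *)
Definition legendre_num (k d : nat) : nat :=
  ('C(2 * k + d, k) * 'C(2 * k + 2 * d, d))%N.

Lemma legendre_num_fact (k d : nat) :
  (legendre_num k d * (k`! * (k + d)`! * d`!) = (2 * k + 2 * d)`!)%N.
Proof.
have := @bin_fact (2 * k + d) k; have := @bin_fact (2 * k + 2 * d) d.
rewrite (_ : 2 * k + 2 * d - d = 2 * k + d)%N; last by lia.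
rewrite (_ : 2 * k + d - k = k + d)%N; last by lia.
move=> <-; last by lia.
move=> <-; last by lia.
by rewrite /legendre_num; ring.
Qed.

Local Arguments legendre : simpl never.

Section LegendreCoef.
Variable F : numFieldType.

Lemma legendre_coef_rec (n j : nat) :
  n.+2%:R * (legendre F n.+2)`_j =
  (2 * n + 3)%:R * ('X * legendre F n.+1)`_j - n.+1%:R * (legendre F n)`_j.
Proof.
have := @legendre_rec F n.+1 isT => /(congr1 (fun Q : {poly F} => Q`_j)).
rewrite coefB !coefZ addn1 /= => ->.
by congr (_%:R * _ - _); lia.
Qed.

Lemma legendre_coef0 (n j : nat) : (n < j)%N || odd (n + j) ->
  (legendre F n)`_j = 0.
Proof.
have [m le_nm] := ubnP n; elim: m n j le_nm => // m IHm [|[|n]] j le_nm Hj.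
- by rewrite coefC; case: j Hj.
- by rewrite coefX; case: j Hj => [|[|[]]].
apply: (@mulfI _ n.+2%:R); first by rewrite pnatr_eq0.
rewrite legendre_coef_rec mulr0 coefXM (IHm n j); [|lia|by lia].
rewrite mulr0 subr0; case: j Hj => [|j] Hj /=; first by rewrite mulr0.
by rewrite IHm ?mulr0 //; lia.
Qed.

Lemma legendre_numE (k d : nat) : (legendre_num k d)%:R =
  (2 * k + 2 * d)`!%:R / (k`!%:R * (k + d)`!%:R * d`!%:R) :> F.
Proof.
rewrite -legendre_num_fact !natrM mulfK //.
by rewrite !mulf_neq0 // pnatr_eq0 -lt0n fact_gt0.
Qed.

(** Once binomials are written with factorials, Bonnet's recurrence for these
    coefficients is an identity of rational functions in [k] and [d].  The
    boundary cases [k = 0] and [d = 0], where one of the two previous terms is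
    missing, are treated apart. *)
Lemma legendre_coef (k d : nat) :
  2 ^+ (2 * k + d) * (legendre F (2 * k + d))`_d =
  (-1) ^+ k * (legendre_num k d)%:R.
Proof.
have [m] := ubnP (2 * k + d); elim: m k d => // m IHm k d le_m.
have factS_F n : n.+1`!%:R = (n%:R + 1) * n`!%:R :> F.
  by rewrite factS natrM -natr1.
have nzf n : n`!%:R != 0 :> F by rewrite pnatr_eq0 -lt0n fact_gt0.
have nzS n : n%:R + 1 != 0 :> F by rewrite natr1 pnatr_eq0.
case: k le_m => [|k] le_m.
  case: d le_m => [|[|d]] le_m.
  - by rewrite coefC.
  - by rewrite coefX /legendre_num /= expr1 expr0 !mulr1 mul1r.
  apply: (@mulfI _ d.+2%:R); first by rewrite pnatr_eq0.
  rewrite add0n mulrCA legendre_coef_rec coefXM /= (@legendre_coef0 d) ?mulr0 ?subr0; last by lia.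
  have := IHm 0%N d.+1; rewrite add0n => IH.
  rewrite exprS mulrCA -!mulrA IH ?expr0 ?mul1r; last by lia.
  rewrite !legendre_numE !add0n.
  rewrite (_ : 2 * d.+2 = (2 * d.+1).+2)%N; last by lia.
  rewrite !factS_F fact0 -![d.+2%:R]natr1 -![d.+1%:R]natr1 !natrD !natrM; field.
  by rewrite nzf nzS !natr1 pnatr_eq0.
case: d le_m => [|d] le_m.
  rewrite addn0 in le_m *.
  rewrite (_ : 2 * k.+1 = (2 * k).+2)%N in le_m *; last by lia.
  apply: (@mulfI _ (2 * k).+2%:R); first by rewrite pnatr_eq0.
  rewrite mulrCA legendre_coef_rec coefXM eqxx mulr0 sub0r.
  have := IHm k 0%N; rewrite addn0 => IH.
  rewrite !exprS -!mulrA mulrN [2 ^+ _ * _]mulrCA IH; last by lia.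
  rewrite !legendre_numE !addn0.
  rewrite (_ : 2 * k.+1 = (2 * k).+2)%N; last by lia.
  rewrite !factS_F -![(2 * k).+2%:R]natr1 -![(2 * k).+1%:R]natr1 !natrM; field.
  by rewrite !nzf nzS.
rewrite (_ : 2 * k.+1 + d.+1 = (2 * k + d).+1.+2)%N; last by lia.
rewrite (_ : 2 * k.+1 + d.+1 = (2 * k + d).+1.+2)%N in le_m; last by lia.
apply: (@mulfI _ (2 * k + d).+1.+2%:R); first by rewrite pnatr_eq0.
rewrite mulrCA legendre_coef_rec coefXM /=.
have := IHm k d.+1; rewrite (_ : 2 * k + d.+1 = (2 * k + d).+1)%N => [IH1|]; last by lia.
have := IHm k.+1 d; rewrite (_ : 2 * k.+1 + d = (2 * k + d).+2)%N => [IH2|]; last by lia.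
rewrite mulrBr [2 ^+ _ * _]mulrCA [X in _ - X]mulrCA.
rewrite [X in _ * (X * _) - _]exprS -[X in _ * X - _]mulrA IH2; last by lia.
rewrite [X in _ - _ * (X * _)]exprS [X in _ - _ * (_ * X * _)]exprS.
rewrite [2 * (2 * _)]mulrA -[X in _ - _ * X]mulrA IH1; last by lia.
rewrite !legendre_numE.
rewrite (_ : 2 * k.+1 + 2 * d.+1 = (2 * k + 2 * d).+4)%N; last by lia.
rewrite (_ : 2 * k.+1 + 2 * d = (2 * k + 2 * d).+2)%N; last by lia.
rewrite (_ : 2 * k + 2 * d.+1 = (2 * k + 2 * d).+2)%N; last by lia.
have -> : (2 * (2 * k + d).+1 + 3)%:R = 2 * (2 * k%:R + d%:R) + 5 :> F.
  rewrite (_ : 2 * (2 * k + d).+1 + 3 = 2 * (2 * k + d) + 5)%N; last by lia.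
  by rewrite natrD natrM natrD natrM.
rewrite !addSn !addnS !exprS !factS_F.
have natS n : n.+1%:R = n%:R + 1 :> F by rewrite natr1.
rewrite !(natS (2 * k + d)%N.+2, natS (2 * k + d)%N.+1, natS (2 * k + d)%N).
rewrite !(natS (2 * k + 2 * d)%N.+2, natS (2 * k + 2 * d)%N.+1,
          natS (2 * k + 2 * d)%N).
have := nzS (k + d)%N.
rewrite !(natrD _ (2 * k)%N, natrD _ k d, natrM _ 2 k, natrM _ 2 d) => nzkd.
field.
have nzkd1 : 1 + (k%:R + d%:R) + 1 != 0 :> F.
  by rewrite [1 + _]addrC -[k%:R + d%:R]natrD !natr1 pnatr_eq0.
by rewrite !nzf !nzS nzkd nzkd1.
Qed.
End LegendreCoef.

(** * Powers of a depressed cubic and their coefficients modulo p *)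

(** In [(x^3 + m x)^(N - j) = x^(N - j) (x^2 + m)^(N - j)] a single term of the
    binomial expansion has degree [2 N], and only if [N - j] is
    even and [3 j <= N]. *)
Lemma coef_depressed_cubic_exp (R : comNzRingType) (m n : R) (N : nat) :
  (('X^3 + m *: 'X + n%:P) ^+ N)`_(2 * N) =
  \sum_(j < N.+1 | (3 * j <= N)%N && ~~ odd (N - j))
    ('C(N, j) * 'C(N - j, (N - 3 * j)./2))%:R * (n ^+ j * m ^+ (N - 3 * j)./2).
Proof.
rewrite exprDn coef_sum [RHS]big_mkcond; apply: eq_bigr => -[j /= lt_jN] _.
rewrite coefMn -polyC_exp coefMC.
have -> : 'X^3 + m *: 'X = 'X * ('X^2 + m%:P) :> {poly R}.
  by rewrite mulrDr -exprS mulrC mul_polyC.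
rewrite exprMn ['X^_ * _]mulrC coefMXn.
have -> : (2 * N < N - j)%N = false by lia.
have -> : (2 * N - (N - j) = N + j)%N by lia.
rewrite exprDn coef_sum.
under eq_bigr => i _ do
  rewrite coefMn -exprM -polyC_exp coefMC coefXn.
case: ifP => [/andP[le3 ev]|not_ev]; last first.
  rewrite big1 ?mul0r ?mul0rn // => -[i /= lt_i] _.
  suff -> : (N + j == 2 * (N - j - i))%N = false by rewrite mul0r mul0rn.
  by apply/negP => /eqP e; move/negP: not_ev; apply; lia.
have lt_i : ((N - 3 * j)./2 < (N - j).+1)%N by lia.
rewrite (bigD1 (Ordinal lt_i)) //= big1 ?addr0 => [|[i /= lti]].
  rewrite (_ : (N + j == _)%N) ?mul1r; last by lia.
  by rewrite natrM -[LHS]mulr_natr -[X in X * _ * _]mulr_natr; ring.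
rewrite -val_eqE /= => ni.
suff -> : (N + j == 2 * (N - j - i))%N = false by rewrite mul0r mul0rn.
by lia.
Qed.

Lemma natf_neq0_lt (R : nzRingType) (p n : nat) :
  p \in [pchar R] -> (0 < n < p)%N -> n%:R != 0 :> R.
Proof.
move=> chp /andP[n0 np]; rewrite -(dvdn_pcharf chp).
by apply/negP => /dvdn_leq; lia.
Qed.

Lemma central_bin_rec (j : nat) :
  (j.+1 * 'C(2 * j.+1, j.+1) = 2 * (2 * j + 1) * 'C(2 * j, j))%N.
Proof.
have pos : (0 < j.+1 * (j`! * j`!))%N by rewrite !muln_gt0 fact_gt0.
apply/eqP; rewrite -(eqn_pmul2r pos); apply/eqP.
have := @bin_fact (2 * j.+1) j.+1; have := @bin_fact (2 * j) j.
rewrite (_ : 2 * j - j = j)%N; last by lia.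
rewrite (_ : 2 * j.+1 - j.+1 = j.+1)%N; last by lia.
rewrite (_ : 2 * j.+1 = (2 * j).+2)%N; last by lia.
rewrite !factS => /(_ _) rel1 /(_ _) rel2.
transitivity ('C((2 * j).+2, j.+1) * (j.+1 * j`! * (j.+1 * j`!)))%N.
  by ring.
rewrite rel2 -?rel1; [by ring | by lia | by lia].
Qed.

Section ModP.

Variables (F : fieldType) (p : nat).
Hypothesis charF : p \in [pchar F].

Let p0 : p%:R = 0 :> F := pcharf0 charF.

(** Mod [p] one has [N = -1/2], and the binomial coefficient of [-1/2] and [j] is
    the central one divided by [(-4)^j]. *)
Lemma bin_half (N j : nat) : p = N.*2.+1 -> (j <= N)%N ->
  'C(N, j)%:R * (-4) ^+ j = 'C(2 * j, j)%:R :> F.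
Proof.
move=> pN; elim: j => [|j IHj] le_jN; first by rewrite !bin0 mul1r.
have nzj : j.+1%:R != 0 :> F by apply: (natf_neq0_lt charF); lia.
apply: (mulfI nzj); rewrite mulrA -natrM mul_bin_left.
have -> : j.+1%:R * 'C(2 * j.+1, j.+1)%:R = 2 * (2 * j%:R + 1) * 'C(2 * j, j)%:R :> F.
  by rewrite -natrM central_bin_rec !(natrM _ _ 'C(_, _), natrM _ 2) natrD natrM.
rewrite -IHj; last by lia.
rewrite natrM natrB; last by lia.
have := p0; rewrite pN -natr1 -muln2 natrM => N0.
rewrite exprS.
have -> : (N%:R - j%:R) * 'C(N, j)%:R * (-4 * (-4) ^+ j) =
  ('C(N, j)%:R * (-4) ^+ j) * (2 * (2 * j%:R + 1) - 2 * (N%:R * 2 + 1)) :> F by ring.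
by rewrite N0; ring.
Qed.

(** The multinomial coefficient [N! / (d! (3 k + e)! (3 k + 2 d + e)!)] with
    [N = 3 (2 k + d) + 2 e], attached to the monomial of degree [2 N] and of
    degree [d] in the constant term of the cubic. *)
Definition hasse_num (e k d : nat) : nat :=
  'C(3 * (2 * k + d) + 2 * e, d) * 'C(3 * (2 * k + d) + 2 * e - d, 3 * k + e).

Lemma hasse_num_fact (e k d : nat) :
  (hasse_num e k d * (d`! * (3 * k + e)`! * (3 * k + 2 * d + e)`!) =
   (3 * (2 * k + d) + 2 * e)`!)%N.
Proof.
rewrite /hasse_num; set n := (3 * (2 * k + d) + 2 * e)%N.
have := @bin_fact n d; have := @bin_fact (n - d) (3 * k + e).
rewrite (_ : n - d - (3 * k + e) = 3 * k + 2 * d + e)%N; last by rewrite /n; lia.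
move=> <-; last by rewrite /n; lia.
move=> <-; last by rewrite /n; lia.
by ring.
Qed.

Lemma hasse_num_rec (e k d : nat) :
  (hasse_num e k.+1 d * ((3 * k + 1 + e) * (3 * k + 2 + e) * (3 * k + 3 + e)) =
   hasse_num e k d.+2 * (d.+2 * d.+1 * (3 * k + 2 * d + 4 + e)))%N.
Proof.
have pos : (0 < d`! * (3 * k + e)`! * (3 * k + 2 * d + 3 + e)`!)%N.
  by rewrite !muln_gt0 !fact_gt0.
apply/eqP; rewrite -(eqn_pmul2r pos); apply/eqP.
have := hasse_num_fact e k.+1 d; have := hasse_num_fact e k d.+2.
rewrite (_ : 2 * k.+1 + d = 2 * k + d.+2)%N; last by lia.
move=> <-.
rewrite (_ : 3 * k + 2 * d.+2 + e = (3 * k + 2 * d + 3 + e).+1)%N; last by lia.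
rewrite (_ : 3 * k.+1 + 2 * d + e = 3 * k + 2 * d + 3 + e)%N; last by lia.
rewrite (_ : 3 * k.+1 + e = (3 * k + e).+3)%N; last by lia.
rewrite !factS => rel.
transitivity (hasse_num e k.+1 d *
  (d`! * ((3 * k + e).+3 * ((3 * k + e).+2 * ((3 * k + e).+1 * (3 * k + e)`!))) *
   (3 * k + 2 * d + 3 + e)`!))%N; first by ring.
by rewrite rel; ring.
Qed.

Lemma legendre_num_rec (k d : nat) :
  (legendre_num k.+1 d * (2 * k.+1 * (2 * k + 2 * d + 3)) =
   legendre_num k d.+2 * (d.+2 * d.+1))%N.
Proof.
have pos : (0 < (k + d).+2 * (k`! * (k + d).+1`! * d`!))%N.
  by rewrite !muln_gt0 !fact_gt0.
apply/eqP; rewrite -(eqn_pmul2r pos); apply/eqP.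
have := legendre_num_fact k.+1 d; have := legendre_num_fact k d.+2.
rewrite (_ : k + d.+2 = (k + d).+2)%N; last by lia.
rewrite (_ : k.+1 + d = (k + d).+1)%N; last by lia.
rewrite (_ : 2 * k.+1 + 2 * d = (2 * k + 2 * d).+2)%N; last by lia.
rewrite (_ : 2 * k + 2 * d.+2 = (2 * k + 2 * d).+4)%N; last by lia.
rewrite [_.+4`!]factS [_.+3`!]factS => rel1 rel2.
transitivity (legendre_num k.+1 d * (k.+1`! * (k + d).+1`! * d`!) *
  (2 * (k + d).+2 * (2 * k + 2 * d + 3)))%N; first by rewrite !factS; ring.
rewrite rel2.
transitivity ((2 * k + 2 * d).+4 * ((2 * k + 2 * d).+3 * (2 * k + 2 * d).+2`!))%N.
  by ring.
by rewrite -rel1 !factS; ring.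
Qed.

(** Induction on [k] at constant [r = 2 k + d].  Mod [p], the factor
    [3 k + 2 d + 4 + e] of [hasse_num_rec] is [- (3 k + 1 + e) / 3] and the factor
    [2 k + 2 d + 3] of [legendre_num_rec] is [- (6 k + 4 + 4 e) / 3]; after this
    substitution the two recurrences differ by the factor 4 / 27.  The case
    [k = 0] reduces to [bin_half]. *)
Lemma hasse_legendre_num (e k d : nat) :
    (e <= 1)%N -> p = (6 * (2 * k + d) + 1 + 4 * e)%N ->
  27 ^+ k * 3 ^+ e * (-4) ^+ (2 * k + d) * (hasse_num e k d)%:R =
  4 ^+ k * (legendre_num k d)%:R :> F.
Proof.
move=> le_e1; elim: k d => [|k IHk] d pE.
  rewrite muln0 add0n in pE *.
  rewrite /hasse_num /legendre_num !muln0 !add0n bin0 mul1n !expr0 !mul1r.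
  have := @bin_half (3 * d + 2 * e) d; rewrite pE => <-; [|lia..].
  rewrite (_ : 3 * d + 2 * e - d = 2 * d + 2 * e)%N; last by lia.
  (* For e = 1 the binomial is 2 d + 2, and 3 (2 d + 2) = p + 1. *)
  suff e1 : 3 ^+ e * 'C(2 * d + 2 * e, e)%:R = 1 :> F.
    rewrite natrM -[RHS]mulr1 -[X in _ = _ * X]e1; ring.
  case: e le_e1 pE => [|[|//]] _ pE; first by rewrite bin0 mulr1.
  rewrite bin1 expr1 -[3]/(3%:R) -natrM (_ : 3 * _ = p + 1)%N; last by lia.
  by rewrite natrD p0 add0r.
have pE' : p = (6 * (2 * k + d.+2) + 1 + 4 * e)%N by lia.
have {}IHk := IHk d.+2 pE'.
rewrite (_ : 2 * k + d.+2 = 2 * k.+1 + d)%N in IHk; last by lia.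
set c := (X in X * _ = _) in IHk.
have := congr1 (fun n => n%:R : F) (legendre_num_rec k d).
have := congr1 (fun n => n%:R : F) (hasse_num_rec e k d).
set U := ((_ * (3 * k + 3 + e))%N in X in X -> _).
set V := (3 * k + 2 * d + 4 + e)%N; set W := (2 * k + 2 * d + 3)%N.
have nzU : U%:R != 0 :> F.
  by rewrite !natrM !mulf_neq0 // (natf_neq0_lt charF) //; lia.
(* Both 3 V + (3 k + 1 + e) and 3 W + (6 k + 4 + 4 e) are equal to p. *)
have VW : 27 * V%:R * (2 * k.+1 * W)%:R = 4 * U%:R :> F.
  have V3 : 3 * V%:R = - (3 * k + 1 + e)%:R :> F.
    apply/eqP; rewrite -addr_eq0 -[3]/(3%:R) -natrM -natrD -p0 pE.
    by apply/eqP; congr _%:R; rewrite /V; lia.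
  have W3 : 3 * W%:R = - (6 * k + 4 + 4 * e)%:R :> F.
    apply/eqP; rewrite -addr_eq0 -[3]/(3%:R) -natrM -natrD -p0 pE.
    by apply/eqP; congr _%:R; rewrite /W; lia.
  rewrite !natrM.
  have -> : 27 * V%:R * (2 * k.+1%:R * W%:R) =
    6 * k.+1%:R * ((3 * V%:R) * (3 * W%:R)) :> F by ring.
  rewrite V3 W3 mulrNN -[6]/(6%:R) -[4]/(4%:R) -!natrM; congr _%:R; rewrite /U.
  by case: (e) le_e1 => [|[|//]] _; ring.
rewrite [in LHS]natrM [in RHS]natrM => recA.
rewrite [in LHS]natrM [in RHS]natrM => recB.
apply: (mulIf nzU).
transitivity (27 * c * ((hasse_num e k.+1 d)%:R * U%:R) : F).
  by rewrite exprS /c; ring.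
rewrite recA [(_ * V)%:R]natrM.
transitivity (27 * V%:R * (c * (hasse_num e k d.+2)%:R) * (d.+2 * d.+1)%:R : F).
  by ring.
rewrite IHk.
transitivity (27 * V%:R * 4 ^+ k *
  ((legendre_num k d.+2)%:R * (d.+2 * d.+1)%:R) : F); first by ring.
rewrite -recB.
transitivity (4 ^+ k * (legendre_num k.+1 d)%:R *
  (27 * V%:R * (2 * k.+1 * W)%:R) : F); first by ring.
by rewrite VW exprS; ring.
Qed.

(** For [t = 21 sqrt 33 / 121], [m = -11] and [n = 14] one has
    [t^2 = - 27 n^2 / (4 m^3)]; this absorbs the factor [(27 / 4)^k] of
    [hasse_legendre_num], and makes the proportionality factor independent of
    [k]. *)
Lemma hasse_legendre_term (e k d : nat) :
    (e <= 1)%N -> p = (6 * (2 * k + d) + 1 + 4 * e)%N ->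
  (-1) ^+ k * (legendre_num k d)%:R * 21 ^+ d * 121 ^+ (2 * k)
    * 33 ^+ d./2 * (-11) ^+ e =
  (-6) ^+ (2 * k + d) * 33 ^+ (2 * k + d)./2 * 3 ^+ e *
    ((hasse_num e k d)%:R * (14 ^+ d * (-11) ^+ (3 * k + e))) :> F.
Proof.
move=> le_e1 pE.
have p_gt1 := prime_gt1 (pcharf_prime charF).
have nz4 : 4 ^+ k != 0 :> F.
  by rewrite expf_neq0 // (natf_neq0_lt charF) //; lia.
apply: (mulfI nz4).
transitivity ((4 ^+ k * (legendre_num k d)%:R) * ((-1) ^+ k * 21 ^+ d *
  121 ^+ (2 * k) * 33 ^+ d./2 * (-11) ^+ e) : F); first by ring.
rewrite -(hasse_legendre_num le_e1 pE).
rewrite (_ : (2 * k + d)./2 = k + d./2)%N; last by lia.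
rewrite !(exprD _ (2 * k)%N d, exprD _ k d./2, exprD _ (3 * k)%N e) !exprM.
transitivity ((27 * (-4) ^+ 2 * -1 * 121 ^+ 2) ^+ k * (-4 * 21) ^+ d *
  (3 ^+ e * (hasse_num e k d)%:R * 33 ^+ d./2 * (-11) ^+ e) : F).
  by rewrite !exprMn; ring.
transitivity ((4 * (-6) ^+ 2 * 33 * (-11) ^+ 3) ^+ k * (-6 * 14) ^+ d *
  (3 ^+ e * (hasse_num e k d)%:R * 33 ^+ d./2 * (-11) ^+ e) : F).
  by congr (_ ^+ _ * _ ^+ _ * _); ring.
by rewrite !exprMn; ring.
Qed.
End ModP.

(** * The Legendre value and the character sum modulo p *)

(** For [e = 0] there is a primitive cube root of unity [w], and [(2 w + 1)^2 = -3].
    For [e = 1] a square root of [-3] would yield such a [w], although 3 does not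
    divide [#|F| - 1].  In both cases [N] is even, so [-1] is harmless. *)
Lemma expf3_half (F : finFieldType) (N h e : nat) :
    #|F| = N.*2.+1 -> 3 != 0 :> F -> (e <= 1)%N -> N = (6 * h + 2 * e)%N ->
  3 ^+ N = (-1) ^+ e :> F.
Proof.
move=> cardF nz3 le_e1 NE.
have n2 := finField_two_neq0 cardF.
have N0 := half_card_gt0 cardF.
have even_N : (-3) ^+ N = 3 ^+ N :> F.
  rewrite NE (_ : 6 * h + 2 * e = 2 * (3 * h + e))%N; last by lia.
  by rewrite !exprM sqrrN.
case: e le_e1 NE => [|[|//]] _ NE.
  have [z prim_z] := finField_primitive_root cardF.
  pose w := z ^+ (4 * h).
  have w3 : w ^+ 3 = 1.
    by rewrite -exprM (_ : 4 * h * 3 = N.*2)%N ?prim_expr_order //; lia.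
  have w1 : w - 1 != 0.
    rewrite subr_eq0 -(prim_order_dvd prim_z); apply/negP => /dvdn_leq; lia.
  have ww : w ^+ 2 + w + 1 = 0.
    by apply: (mulfI w1); rewrite mulr0; transitivity (w ^+ 3 - 1); [ring | rewrite w3 subrr].
  have sq : (2 * w + 1) ^+ 2 = -3.
    transitivity (4 * (w ^+ 2 + w + 1) - 3); first by ring.
    by rewrite ww; ring.
  rewrite -even_N -sq -exprM mul2n expf_fermat //.
  by move: nz3; rewrite -oppr_eq0 -sq expf_eq0.
have := expf_half cardF nz3 => /orP[/eqP e3|/eqP->]; last by rewrite expr1.
have c3 : qchar N (-3 : F) = 1 by apply: (qchar_inj cardF); rewrite // even_N e3.
have [y y2] := qchar1_sqr cardF c3.
pose w := (y - 1) / 2.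
have ww : w ^+ 2 + w + 1 = 0.
  have w2 : 2 * w = y - 1 by rewrite /w; field.
  apply: (mulfI n2); apply: (mulfI n2); rewrite !mulr0.
  transitivity ((2 * w + 1) ^+ 2 + 3); first by ring.
  by rewrite w2 subrK -y2; ring.
have w3 : w ^+ 3 = 1.
  transitivity (1 + (w - 1) * (w ^+ 2 + w + 1)); first by ring.
  by rewrite ww mulr0 addr0.
have nzw : w != 0.
  by apply: contra_eq_neq w3 => ->; rewrite expr0n eq_sym oner_eq0.
have := expf_fermat cardF nzw.
rewrite (_ : N.*2 = 3 * (4 * h + 1) + 1)%N; last by lia.
rewrite exprD exprM w3 expr1n mul1r expr1 => w1.
have three0 : 3 = 0 :> F by rewrite -ww w1; ring.
by rewrite three0 eqxx in nz3.
Qed.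

Lemma coef_hasse_num (R : comNzRingType) (m n : R) (r e : nat) : (e <= 1)%N ->
  (('X^3 + m *: 'X + n%:P) ^+ (3 * r + 2 * e))`_(2 * (3 * r + 2 * e)) =
  \sum_(j < r.+1 | ~~ odd (r - j))
    (hasse_num e (r - j)./2 j)%:R * (n ^+ j * m ^+ (3 * (r - j)./2 + e)).
Proof.
move=> le_e1; rewrite coef_depressed_cubic_exp.
pose G j : R := (hasse_num e (r - j)./2 j)%:R * (n ^+ j * m ^+ (3 * (r - j)./2 + e)).
have le_r : (r.+1 <= (3 * r + 2 * e).+1)%N by lia.
rewrite [RHS](big_ord_widen_cond _ (fun j => ~~ odd (r - j)) G le_r).
apply: eq_big => [j | j /andP[le_j ev]].
  by apply/andP/andP => -[H1 H2]; split; lia.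
rewrite /G /hasse_num.
have -> : ((3 * r + 2 * e - 3 * j)./2 = 3 * (r - j)./2 + e)%N by lia.
by have -> : (2 * (r - j)./2 + j = r)%N by lia.
Qed.

Lemma sum_qchar_hasse (F : finFieldType) (N : nat) :
    #|F| = N.*2.+1 ->
  (\sum_(x : F) qchar N (x ^+ 3 - 11 * x + 14))%:~R =
  - (('X^3 + (-11) *: 'X + 14%:P) ^+ N)`_(2 * N) :> F.
Proof.
move=> cardF; have N0 := half_card_gt0 cardF.
rewrite mul2n -(sum_horner cardF); last first.
  apply: (leq_trans (size_poly_exp_leq _ _)).
  set Q := 'X^3 + _ + _.
  have sQ : (size Q <= 4)%N.
    rewrite (leq_trans (size_polyD _ _)) // geq_max.
    rewrite (leq_trans (size_polyD _ _)) ?geq_max ?size_polyXn /=.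
      by rewrite (leq_trans (size_polyC_leq1 _)).
    by rewrite (leq_trans (size_scale_leq _ _)) ?size_polyX.
  apply: (@leq_trans (3 * N).+1); last by lia.
  by rewrite ltnS leq_mul2r; case: (size Q) sQ => [|n /= sQ]; rewrite ?orbT // -ltnS sQ orbT.
rewrite rmorph_sum; apply: eq_bigr => x _ /=; rewrite qcharE //.
rewrite horner_exp -[RHS]/(_ ^+ N).
have -> : ('X^3 + (-11) *: 'X + 14%:P).[x] = x ^+ 3 - 11 * x + 14.
  by rewrite !hornerD hornerXn hornerZ hornerX hornerC mulNr.
by [].
Qed.

(** An integer because all exponents of [sqrt 33] in [P_r] have the parity of [r]:
    it is [242^r P_r(t)] divided by [sqrt 33] if [r] is odd; the base 242 clears
    the powers of 2 of the coefficients and the denominator 121 of [t]. *)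
Definition legendre_int (r : nat) : int :=
  \sum_(j < r.+1 | ~~ odd (r - j))
    (-1) ^+ (r - j)./2 * (legendre_num (r - j)./2 j)%:Z * 21 ^+ j
      * 121 ^+ (2 * (r - j)./2) * 33 ^+ j./2.

Lemma legendre_intE (r : nat) :
  242 ^+ r * (legendre algC r).[21 * sqrt33 / 121] =
  sqrt33 ^+ odd r * (legendre_int r)%:~R.
Proof.
have sqrt33K : sqrt33 ^+ 2 = 33 by rewrite sqrtCK.
have sP : (size (legendre algC r) <= r.+1)%N.
  by apply/leq_sizeP => j lt_rj; rewrite legendre_coef0 // lt_rj.
rewrite (horner_coef_wide _ sP) rmorph_sum !mulr_sumr /=.
rewrite [RHS]big_mkcond; apply: eq_bigr => -[j /= lt_j] _.
case: ifP => [ev|/negbFE od]; last first.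
  by rewrite legendre_coef0 ?mul0r ?mulr0 //; lia.
set k := (r - j)./2; have rE : r = (2 * k + j)%N by rewrite /k; lia.
have := legendre_coef algC k j; rewrite -rE => cE.
have -> : odd r = odd j by rewrite rE; lia.
have -> : 242 ^+ r = 2 ^+ r * 121 ^+ r :> algC by rewrite -exprMn -natrM.
transitivity ((2 ^+ r * (legendre algC r)`_j) * (121 ^+ r * (21 * sqrt33 / 121) ^+ j)).
  by ring.
rewrite cE {1}rE exprD !exprMn.
have -> : sqrt33 ^+ j = sqrt33 ^+ odd j * 33 ^+ j./2.
  by rewrite -sqrt33K -exprM -exprD mul2n odd_double_half.
rewrite exprVn.
have nz : 121 ^+ j != 0 :> algC by rewrite expf_neq0 // pnatr_eq0.
move: (legendre_num k j) => L.
by rewrite !rmorphM /= !rmorphXn /= rmorphN1; field.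
Qed.

Lemma legendre_int_modp (p r e : nat) (F : fieldType) : p \in [pchar F] ->
    (e <= 1)%N -> p = (6 * r + 1 + 4 * e)%N ->
  (legendre_int r)%:~R * (-11) ^+ e =
  (-6) ^+ r * 33 ^+ r./2 * 3 ^+ e *
   (('X^3 + (-11) *: 'X + 14%:P) ^+ (3 * r + 2 * e))`_(2 * (3 * r + 2 * e)) :> F.
Proof.
move=> charF le_e1 pE; rewrite coef_hasse_num // rmorph_sum mulr_suml mulr_sumr.
apply: eq_bigr => -[j /= lt_j] ev.
set k := (r - j)./2; have rE : r = (2 * k + j)%N by rewrite /k; lia.
rewrite rE in pE; have := hasse_legendre_term charF le_e1 pE; rewrite -rE => <-.
move: (legendre_num k j) => L.
by rewrite !rmorphM /= !rmorphXn /= rmorphN1.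
Qed.

(** * Reduction of the congruence to the prime field *)

Lemma legendre_symbolE (p : nat) (c : int) : prime p -> p <> 2%N ->
  (legendre_symbol c p)%:~R = c%:~R ^+ p./2 :> 'F_p.
Proof.
move=> pr_p p_neq2.
have charF := pchar_Fp pr_p.
have odd_p : odd p by apply: contraT => /negbTE ev; have := even_prime pr_p; rewrite ev; case.
have cardF : #|'F_p| = p./2.*2.+1 by rewrite card_Fp // -[LHS]odd_double_half odd_p.
rewrite /legendre_symbol (dvdz_pcharf charF).
case: eqP => [->|/eqP nzc]; first by rewrite (expf0_half cardF).
case: existsP => [[x]|no_root].
  rewrite eqz_mod_dvd (dvdz_pcharf charF) rmorphB rmorphXn /= subr_eq0 => /eqP xc.
  rewrite -xc -exprM mul2n expf_fermat //; apply: contraNneq nzc => x0.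
  by rewrite -xc x0 expr0n.
case/orP: (expf_half cardF nzc) => /eqP cN; last by rewrite cN.
have [|y yc] := qchar1_sqr cardF (x := c%:~R).
  exact: (qchar_inj cardF).
have lt_y : (y < p)%N by have := ltn_ord y; rewrite [X in (_ < X)%N]Fp_cast.
case: no_root; exists (Ordinal lt_y).
rewrite eqz_mod_dvd (dvdz_pcharf charF) rmorphB rmorphXn /= subr_eq0 yc.
by rewrite -pmulrn natr_Zp.
Qed.

(** The reduced denominator divides [n]. *)
Lemma p_integral_frac (p n : nat) (q : int) : (0 < n)%N -> coprime n p ->
  q%:~R / n%:R \in p_integral p.
Proof.
move=> n0 co_np; set x : rat := _ / _.
rewrite /p_integral inE.
have eqx : numq x * n%:Z = q * denq x.
  apply: (@intr_inj rat); rewrite !intrM.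
  have := divq_num_den x; rewrite {3}/x => e.
  have nzd : (denq x)%:~R != 0 :> rat by rewrite intr_eq0 denq_neq0.
  have nzn : n%:R != 0 :> rat by rewrite pnatr_eq0 -lt0n.
  apply/eqP; rewrite -eqr_div //; apply/eqP; exact: e.
apply: coprime_dvdl co_np.
have : (denq x %| numq x * n%:Z)%Z by apply/dvdzP; exists q.
rewrite Gauss_dvdzr; first by rewrite dvdzE.
by rewrite coprimezE coprime_sym coprime_num_den.
Qed.

Lemma p_integral0 (p : nat) : 0 \in p_integral p.
Proof. by rewrite /p_integral inE /= coprime1n. Qed.

Lemma congr_mod_int (p d : nat) (x : algC) (w c : int) :
    (0 < d)%N -> coprime d p -> d%:R * x = w%:~R -> (p %| w - d%:Z * c)%Z ->
  congr_mod p x c%:~R.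
Proof.
move=> d0 co_dp dx /dvdzP[q wq].
have nzd : d%:R != 0 :> algC by rewrite pnatr_eq0 -lt0n.
exists (q%:~R / d%:R).
  exists (q%:~R / d%:R), 0; split; first exact: p_integral_frac.
    exact: p_integral0.
  by rewrite rmorph0 mul0r addr0 fmorph_div /= ratr_int ratr_nat.
apply: (mulfI nzd); rewrite mulrBr dx.
transitivity ((w - d%:Z * c)%:~R : algC); first by rewrite rmorphB rmorphM.
by rewrite wq rmorphM /=; field.
Qed.

Lemma congr_mod_sqrt33 (p d : nat) (x : algC) (w : int) :
    (0 < d)%N -> coprime d p -> d%:R * x = sqrt33 * w%:~R -> (p %| w)%Z ->
  congr_mod p x 0.
Proof.
move=> d0 co_dp dx /dvdzP[q wq].
have nzd : d%:R != 0 :> algC by rewrite pnatr_eq0 -lt0n.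
exists (q%:~R / d%:R * sqrt33).
  exists 0, (q%:~R / d%:R); split; last first.
  - by rewrite rmorph0 add0r fmorph_div /= ratr_int ratr_nat.
  - exact: p_integral_frac.
  exact: p_integral0.
by apply: (mulfI nzd); rewrite subr0 dx wq rmorphM /=; field.
Qed.

Section ReductionModP.

Variables (F : finFieldType) (p r e : nat).
Hypotheses (cardF : #|F| = p) (pr_p : prime p).
Hypotheses (le_e1 : (e <= 1)%N) (pE : p = (6 * r + 1 + 4 * e)%N).
Hypothesis nz11 : 11 != 0 :> F.
Local Notation N := (3 * r + 2 * e)%N.

Let cardN : #|F| = N.*2.+1.
Proof. by rewrite cardF [LHS]pE; lia. Qed.

Lemma legendre_int_qchar :
  (legendre_int r)%:~R * (-11) ^+ e =
  (-6) ^+ r * 33 ^+ r./2 * 3 ^+ e *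
    - (\sum_(x : F) qchar N (x * (x ^+ 2 - 1)))%:~R :> F.
Proof.
have charF : p \in [pchar F] by apply: (@card_finPcharP _ _ 1).
rewrite (legendre_int_modp charF le_e1 pE) -[_`_(2 * N)]opprK.
by rewrite -(sum_qchar_hasse cardN) (sum_qchar_isogeny cardN).
Qed.

Lemma legendre_int_3mod4 : odd r -> (legendre_int r)%:~R = 0 :> F.
Proof.
move=> odd_r; have := legendre_int_qchar.
rewrite (sum_qchar_odd cardN) => [/eqP|].
  rewrite mulr0z oppr0 mulr0 mulf_eq0 expf_eq0 oppr_eq0 (negbTE nz11) andbF.
  by rewrite orbF => /eqP.
apply: (qchar_inj cardN) => //.
by rewrite -signr_odd (_ : odd N) // oddD !oddM odd_r.
Qed.

(** Dividing by common factors, the constants to compare are powers of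
    [X = 3^j] and [Y = 11^j] with [j = 3 h + e = (p - 1) / 4]; they agree since
    [X^2 = (-1)^e] and [Y^4 = 1]. *)
Lemma legendre_int_1mod4 (h : nat) (a b : int) : 3 != 0 :> F -> r = (2 * h)%N ->
    p%:Z = a ^+ 2 + b ^+ 2 -> (4 %| a - 1)%Z ->
  (legendre_int r)%:~R =
    242 ^+ r * (33 ^+ N * (-33) ^+ (3 * h + e) * (2 * a%:~R)) :> F.
Proof.
move=> nz3 rE pab a1; set j := (3 * h + e)%N.
have Nj : N = (2 * j)%N by rewrite /j rE; lia.
have sumE : \sum_(x : F) qchar N (x * (x ^+ 2 - 1)) = - 2 * a * (-1) ^+ j.
  apply: (jacobsthal_two_squaresE cardN cardF pr_p _ pab a1).
    by rewrite pE rE /j; lia.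
  by apply: (qchar_inj cardN) => //; rewrite Nj exprM sqrrN !expr1n.
have := legendre_int_qchar; rewrite sumE !rmorphM /= rmorphXn /= => WE.
have nze : (-11) ^+ e != 0 :> F by rewrite expf_neq0 // oppr_eq0.
apply: (mulIf nze); rewrite {}WE.
pose X : F := 3 ^+ j; pose Y : F := 11 ^+ j.
have X2 : X ^+ 2 = (-1) ^+ e.
  have NE : N = (6 * h + 2 * e)%N by rewrite rE; lia.
  rewrite /X -exprM -(expf3_half cardN nz3 le_e1 NE).
  by rewrite Nj mulnC.
have Y4 : Y ^+ 4 = 1.
  rewrite /Y -exprM (_ : j * 4 = N.*2)%N; last by rewrite Nj; lia.
  exact: (expf_fermat cardN).
have XE : X = 27 ^+ h * 3 ^+ e.
  by rewrite /X /j exprD exprM; congr (_ ^+ _ * _); ring.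
have YE : Y = 11 ^+ h * 121 ^+ h * 11 ^+ e.
  by rewrite /Y /j exprD exprM -exprMn; congr (_ ^+ _ * _); ring.
have E33 : 33 ^+ N * 33 ^+ j = (X * Y) ^+ 3.
  rewrite /X /Y -exprMn -exprD -exprM (_ : N + j = j * 3)%N; last by lia.
  by congr (_ ^+ _); ring.
have key : (-6) ^+ r * 33 ^+ r./2 * 3 ^+ e =
    242 ^+ r * (33 ^+ N * 33 ^+ j) * (-11) ^+ e :> F.
  rewrite E33 rE (_ : (2 * h)./2 = h)%N; last by lia.
  rewrite !exprM.
  transitivity (4 ^+ h * 11 ^+ h * X : F).
    rewrite XE -[X in X * _ = _]exprMn -[in RHS]exprMn mulrA -[in RHS]exprMn.
    by congr (_ ^+ _ * _); ring.
  transitivity (4 ^+ h * 11 ^+ h * X * (X ^+ 2 * (-1) ^+ e) * Y ^+ 4 : F).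
    by rewrite X2 Y4 -expr2 -exprM mulnC exprM sqrrN !expr1n !mulr1.
  transitivity ((4 * 11 * 11 * 121) ^+ h * (X * Y) ^+ 3 * ((-1) * 11) ^+ e : F).
    by rewrite [Y ^+ 4]exprSr {2}YE !exprMn; ring.
  by congr (_ ^+ _ * _ * _ ^+ _); ring.
have -> : (-33) ^+ j = (-1) ^+ j * 33 ^+ j :> F by rewrite -exprMn mulN1r.
by rewrite key; ring.
Qed.

End ReductionModP.

Unset Implicit Arguments.

Theorem corollary2p1 (p : nat) (p_prime : prime p)
    (p_neq2 : p <> 2%N) (p_neq3 : p <> 3%N) (p_neq11 : p <> 11%N) :
  (forall a b : int,
     p = 1 %[mod 4] ->
     p%:Z = a ^+ 2 + b ^+ 2 ->
     (4 %| a - 1)%Z ->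
     congr_mod p (legendre algC (p %/ 6)).[21 * sqrt33 / 121]
       (legendre_symbol 33 p * (-33) ^+ ((p - 1) %/ 4) * (2 * a))%:~R)
  /\
  (p = 3 %[mod 4] ->
     congr_mod p (legendre algC (p %/ 6)).[21 * sqrt33 / 121] 0).
Proof.
have charF := pchar_Fp p_prime.
have p_coprime n : prime n -> p <> n -> coprime n p.
  by move=> pr_n pn; rewrite prime_coprime // dvdn_prime2 // eq_sym; apply/eqP.
have not2 : ~~ (2 %| p)%N by rewrite -prime_coprime // p_coprime.
have not3 : ~~ (3 %| p)%N by rewrite -prime_coprime // p_coprime.
have nz n : prime n -> p <> n -> n%:R != 0 :> 'F_p.
  move=> pr_n pn; rewrite -(dvdn_pcharf charF) -prime_coprime // coprime_sym.
  exact: p_coprime.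
have co_d r : coprime (242 ^ r) p.
  rewrite coprimeXl // (_ : 242 = 2 * 11 ^ 2)%N //.
  by rewrite coprimeMl coprimeXl !p_coprime.
have d_gt0 r : (0 < 242 ^ r)%N by rewrite expn_gt0.
set r := (p %/ 6)%N; set t := 21 * sqrt33 / 121.
have [e le_e1 pE] : exists2 e, (e <= 1)%N & p = (6 * r + 1 + 4 * e)%N.
  have [h|h] : p = (6 * r + 1)%N \/ p = (6 * r + 5)%N by rewrite /r; lia.
    by exists 0%N; lia.
  by exists 1%N; lia.
have cardFp := card_Fp p_prime.
have PW : (242 ^ r)%:R * (legendre algC r).[t] =
          sqrt33 ^+ odd r * (legendre_int r)%:~R.
  by rewrite natrX legendre_intE.
split=> [a b p1 pab a1|p3]; last first.
  have odd_r : odd r by clear -pE p3; lia.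
  apply: (congr_mod_sqrt33 (d_gt0 r) (co_d r)); first by rewrite PW odd_r expr1.
  rewrite (dvdz_pcharf charF); apply/eqP.
  exact: (legendre_int_3mod4 cardFp p_prime le_e1 pE (nz 11%N isT p_neq11)).
have [h rE] : exists h, r = (2 * h)%N by exists (r./2); clear -pE p1; lia.
rewrite (_ : odd r = false) ?expr0 ?mul1r in PW; last by rewrite rE oddM.
apply: (congr_mod_int (d_gt0 r) (co_d r) PW).
rewrite (dvdz_pcharf charF) rmorphB subr_eq0; apply/eqP.
have -> : ((p - 1) %/ 4 = 3 * h + e)%N by clear -pE rE; lia.
rewrite !rmorphM /= rmorphXn /= legendre_symbolE //.
have -> : (p./2 = 3 * r + 2 * e)%N by clear -pE; lia.
have -> : (242 ^ r)%N%:Z%:~R = 242 ^+ r :> 'F_p by rewrite -pmulrn natrX.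
exact: (legendre_int_1mod4 cardFp p_prime le_e1 pE (nz 11%N isT p_neq11)
          (nz 3%N isT p_neq3) rE pab a1).
Qed.
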